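(* Let $q$ be an odd prime power with $q\equiv 3\bmod 4$. Let $P=A\times B$ with $A,B\subset\mathbb{F}_q^2$ and let $R$ be a set of rigid motions in $\mathbb{F}_q^2$. Then $$\left| I(P,R)-\frac{|P||R|}{q^2}\right|\ll q^{1/2}|P|^{1/2}|R|^{1/2}\min\big(|A|^{1/4},|B|^{1/4}\big).$$
   Context: $\mathbb{F}_q$ is the finite field with $q$ elements. $O(2)$ is the group of $2\times 2$ orthogonal matrices over $\mathbb{F}_q$ (those preserving $\|x\|=x_1^2+x_2^2$). A rigid motion is a map $x\mapsto gx+z$ with $g\in O(2)$, $z\in\mathbb{F}_q^2$, identified with the pair $(g,z)$; so $R\subset O(2)\times\mathbb{F}_q^2$. The number of incidences is $I(P,R)=\#\{(x,y,g,z): (x,y)\in P,\ (g,z)\in R,\ x=gy+z\}$. $X\ll Y$ means $|X|\le CY$ for an absolute constant $C>0$. *)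

(* Defs.v *)
From mathcomp Require Import all_boot all_order all_algebra.
From mathcomp Require Import reals exp.

Set Implicit Arguments.
Unset Strict Implicit.
Unset Printing Implicit Defensive.

Import Order.TTheory GRing.Theory Num.Theory.
Local Open Scope ring_scope.

Definition qnorm (F : finFieldType) (x : 'cV[F]_2) : F :=
  x 0 0 ^+ 2 + x 1 0 ^+ 2.

Definition O2 (F : finFieldType) : {set 'M[F]_2} :=
  [set g : 'M[F]_2 | [forall x : 'cV[F]_2, qnorm (g *m x) == qnorm x]].

(* The pair (g, z) stands for the map x |-> g x + z. *)
Definition rigid_motions (F : finFieldType) : {set 'M[F]_2 * 'cV[F]_2} :=
  setX (O2 F) [set: 'cV[F]_2].

Definition incidences (F : finFieldType) (P : {set 'cV[F]_2 * 'cV[F]_2})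
    (M : {set 'M[F]_2 * 'cV[F]_2}) : nat :=
  #|[set t : ('cV[F]_2 * 'cV[F]_2) * ('M[F]_2 * 'cV[F]_2) |
      [&& t.1 \in P, t.2 \in M & t.1.1 == t.2.1 *m t.1.2 + t.2.2]]|.

(* Main.v *)
Require Import Defs.
From mathcomp Require Import all_boot all_order all_algebra.
From mathcomp Require Import reals exp.
From mathcomp Require Import fingroup finfield classfun character algC.
From mathcomp Require Import ring lra.

(** For a rigid motion (g, z), the pairs (a, b) of A x B with a = g b + z are
    counted by the size of the overlap of A with the image of B.  For fixed g
    this size has mean |A||B|/q^2 as z varies, so the incidence count minus
    |P||M|/q^2 is the sum over M of the deviations from that mean, and by
    Cauchy-Schwarz its square is at most |M| times the second moment E of the
    deviation over all rigid motions.  The point is to show that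
    E^2 <= 12 q^2 |A|^2 |B|^2 min(|A|, |B|).

    Fix a nontrivial additive character psi of the field.  By Plancherel in z
    [variance_overlap], q^2 E is the sum over g in O(2) and over frequencies
    y <> 0 of |A^(g y)|^2 |B^(y)|^2, where A^ and B^ are the Fourier transforms
    of the indicators.  As q = 3 mod 4, the form x1^2 + x2^2 has no isotropic
    vector, so at most two elements of O(2) carry a given y <> 0 to a given
    vector [O2_fiber_le2]; hence q^2 E is at most twice the sum of
    |A^(x)|^2 |B^(y)|^2 over pairs with x and y on the same circle
    [sum_O2_le].  If s bounds the mass of |A^|^2 on every circle, this is at
    most 2 s q^2 |B|.

    The bound s^2 <= 3 q^2 |A|^3 is a restriction estimate for circles
    [circle_restriction].  By duality it follows from an L^2 to L^4 bound for
    the transform of a function h carried by a circle [circle_extension], and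
    the fourth moment of that transform is q^2 times the squared L^2 norm of
    h * h.  The latter is controlled because a nonzero vector v is a sum of two
    points x and v - x of a given circle in at most one way up to exchanging
    the two [circle_sum_unique].  Exchanging A and B gives the minimum.

    Since psi takes values in the algebraic complex numbers, the estimate is
    proved there; after clearing denominators both sides of its fourth power
    are integers, and so it holds over the reals as well. *)

Set Implicit Arguments.
Unset Strict Implicit.
Unset Printing Implicit Defensive.

Import Order.TTheory GRing.Theory Num.Theory.
Local Open Scope ring_scope.

(** * The anisotropic plane *)

(** Translation by 1 permutes the field but adds its cardinality to the sum of
    all elements. *)
Lemma natr_card_eq0 (K : finFieldType) : #|K|%:R = 0 :> K.
Proof.
have : \sum_(x : K) x = \sum_(x : K) (x + 1).
  by rewrite [LHS](reindex_inj (addIr 1)).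
rewrite big_split /= sumr_const => /eqP.
by rewrite eq_sym -subr_eq0 addrAC subrr add0r => /eqP.
Qed.

Section CardThreeMod4.
Variables (F : finFieldType).
Hypothesis q3 : (#|F| %% 4 = 3)%N.

Lemma two_neq0 : 2%:R != 0 :> F.
Proof.
apply/eqP=> two0; have := natr_card_eq0 F.
rewrite (divn_eq #|F| 4) q3 -[4%N]/(2 * 2)%N mulnA natrD natrM two0 mulr0 add0r.
by rewrite (natrD _ 2 1) two0 add0r => /eqP; rewrite oner_eq0.
Qed.

(** If x^2 = -1 then x^q = x^3 = -x, against x^q = x. *)
Lemma sqr_neqN1 (x : F) : x ^+ 2 != -1.
Proof.
apply/eqP=> x2; have x3: x ^+ 3 = x.
  rewrite -[RHS]expf_card (divn_eq #|F| 4) q3 addnC exprD mulnC exprM.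
  by rewrite -[4%N]/(2 * 2)%N exprM x2 sqrrN expr1n expr1n mulr1.
have /eqP: 2%:R * x = 0.
  have : x * x ^+ 2 = x by rewrite -exprS.
  rewrite x2 mulrN1 => /eqP.
  by rewrite eq_sym -subr_eq0 opprK -mulr2n mulr_natl => /eqP.
rewrite mulf_eq0 (negPf two_neq0) /= => /eqP x0.
by move/eqP: x2; rewrite x0 expr0n eq_sym oppr_eq0 oner_eq0.
Qed.

Lemma sum_sqr_eq0 (a b : F) : a ^+ 2 + b ^+ 2 = 0 -> a = 0 /\ b = 0.
Proof.
move=> ab; have b0: b = 0.
  apply/eqP; apply: contraTT isT => nb; have := sqr_neqN1 (a / b).
  rewrite expr_div_n.
  have -> : a ^+ 2 = - b ^+ 2 by apply/eqP; rewrite -subr_eq0 opprK ab.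
  by rewrite mulNr divff ?eqxx // expf_neq0.
by move/eqP: ab; rewrite b0 expr0n addr0 expf_eq0 /= => /eqP ->.
Qed.
End CardThreeMod4.

Definition dot (F : finFieldType) (x y : 'cV[F]_2) : F :=
  x 0 0 * y 0 0 + x 1 0 * y 1 0.

Section Plane.
Variable F : finFieldType.
Implicit Types (x y u v w : 'cV[F]_2) (g : 'M[F]_2).

Lemma ord2P (i : 'I_2) : (i == 0) || (i == 1).
Proof. by case: i => [[|[|i]] Hi]. Qed.

Lemma cV2P x y : x 0 0 = y 0 0 -> x 1 0 = y 1 0 -> x = y.
Proof.
move=> e0 e1; apply/colP=> i.
by case/orP: (ord2P i) => /eqP ->.
Qed.

Lemma mulmx2E g x i : (g *m x) i 0 = g i 0 * x 0 0 + g i 1 * x 1 0.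
Proof.
rewrite mxE !big_ord_recl big_ord0 addr0.
by congr (g i _ * x _ 0 + g i _ * x _ 0); apply/val_inj.
Qed.

Lemma dotDr x y z : dot x (y + z) = dot x y + dot x z.
Proof. by rewrite /dot !mxE; ring. Qed.
Lemma dotDl x y z : dot (x + y) z = dot x z + dot y z.
Proof. by rewrite /dot !mxE; ring. Qed.
Lemma dotC x y : dot x y = dot y x.
Proof. by rewrite /dot; ring. Qed.
Lemma dotNr x y : dot x (- y) = - dot x y.
Proof. by rewrite /dot !mxE; ring. Qed.
Lemma dot0r x : dot x 0 = 0.
Proof. by rewrite /dot !mxE; ring. Qed.
Lemma dotxx x : dot x x = qnorm x.
Proof. by rewrite /dot /qnorm; ring. Qed.
Lemma qnormD x y : qnorm (x + y) = qnorm x + qnorm y + 2%:R * dot x y.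
Proof. by rewrite /dot /qnorm !mxE; ring. Qed.

Hypothesis q3 : (#|F| %% 4 = 3)%N.

Lemma qnorm_eq0 x : (qnorm x == 0) = (x == 0).
Proof.
apply/eqP/eqP => [/(sum_sqr_eq0 q3)[x0 x1]|->]; last by rewrite -dotxx dot0r.
by apply: cV2P; rewrite mxE.
Qed.

Lemma O2_qnorm g x : g \in O2 F -> qnorm (g *m x) = qnorm x.
Proof. by rewrite inE => /forallP/(_ x)/eqP. Qed.

Lemma O2_dot g x y : g \in O2 F -> dot (g *m x) (g *m y) = dot x y.
Proof.
move=> Og; have := O2_qnorm (x + y) Og.
rewrite mulmxDr !qnormD !O2_qnorm // => /addrI /mulfI; apply.
exact: two_neq0.
Qed.

Lemma O2_inj g : g \in O2 F -> injective (mulmx g : 'cV[F]_2 -> 'cV[F]_2).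
Proof.
move=> Og x y /eqP; rewrite -subr_eq0 -mulmxBr -qnorm_eq0 O2_qnorm //.
by rewrite qnorm_eq0 subr_eq0 => /eqP.
Qed.

Definition perp x : 'cV[F]_2 := \col_i (if i == 0 then - x 1 0 else x 0 0).

Lemma perp0 x : perp x 0 0 = - x 1 0. Proof. by rewrite mxE. Qed.
Lemma perp1 x : perp x 1 0 = x 0 0. Proof. by rewrite mxE. Qed.

Lemma qnorm_perp x : qnorm (perp x) = qnorm x.
Proof. by rewrite /qnorm perp0 perp1; ring. Qed.
Lemma dot_perp x : dot x (perp x) = 0.
Proof. by rewrite /dot perp0 perp1; ring. Qed.

Lemma dot_perp_sqr x y :
  dot x y ^+ 2 + dot (perp x) y ^+ 2 = qnorm x * qnorm y.
Proof. by rewrite /dot /qnorm perp0 perp1; ring. Qed.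

Lemma dot_perp_eq0 x y : x != 0 -> dot x y = 0 -> dot (perp x) y = 0 -> y = 0.
Proof.
move=> nx xy px; have /eqP := dot_perp_sqr x y.
rewrite xy px !expr0n addr0 eq_sym mulf_eq0 !qnorm_eq0 (negPf nx) /=.
by move/eqP.
Qed.

Lemma orthogonal_same_norm x y : x != 0 -> dot x y = 0 -> qnorm y = qnorm x ->
  y = perp x \/ y = - perp x.
Proof.
move=> nx xy nyx; have /eqP := dot_perp_sqr x y.
rewrite xy expr0n add0r nyx -expr2 eqf_sqr.
case/orP=> /eqP e; [left | right]; apply/eqP; rewrite -subr_eq0;
  apply/eqP/(dot_perp_eq0 nx); rewrite ?opprK ?dotDr ?dotNr ?xy ?dot_perp ?dotxx
    ?qnorm_perp ?e ?oppr0 ?addr0 ?subrr ?addNr //.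
Qed.

(** Such a g maps perp u to a vector orthogonal to w of the same norm, hence to
    perp w or - perp w, and g is determined by its values on the basis u,
    perp u. *)
Lemma O2_fiber_le2 u w : u != 0 ->
  (#|[set g in O2 F | (g *m u == w)]| <= 2)%N.
Proof.
move=> nu; set S := [set _ in _ | _].
case: (set_0Vmem S) => [->|[g0]]; first by rewrite cards0.
rewrite inE => /andP[Og0 /eqP g0u].
have nw: w != 0 by rewrite -qnorm_eq0 -g0u O2_qnorm // qnorm_eq0.
pose side g := g *m perp u == perp w.
suff side_inj: {in S &, injective side}.
  by rewrite -(card_in_imset side_inj) (leq_trans (max_card _)) ?card_bool.
have key g : g \in S ->
    g *m perp u = if g *m perp u == perp w then perp w else - perp w.
  rewrite inE => /andP[Og /eqP gu].
  case: eqP => [//|ne]; 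
    have [|||//] := @orthogonal_same_norm w (g *m perp u) nw.
  - by rewrite -gu O2_dot // dot_perp.
  - by rewrite O2_qnorm // qnorm_perp -gu O2_qnorm.
  by [].
move=> g h gS hS; rewrite /side => e.
have pe: g *m perp u = h *m perp u by rewrite (key _ gS) (key _ hS) e.
move: gS hS; rewrite !inE => /andP[_ /eqP gu] /andP[_ /eqP hu].
(* every row of g - h is orthogonal to u and to perp u *)
suff /eqP : (g - h)^T = 0 by rewrite trmx_eq0 subr_eq0 => /eqP.
apply/matrixP=> j i; rewrite [RHS]mxE.
suff: col i (g - h)^T = 0 by move/colP/(_ j); rewrite !mxE.
have cE k : (col i (g - h)^T) k 0 = g i k - h i k by rewrite !mxE.
apply: (dot_perp_eq0 nu); rewrite /dot !cE.
  have: (g *m u) i 0 = (h *m u) i 0 by rewrite gu hu.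
  by rewrite !mulmx2E => /eqP; rewrite -subr_eq0 => /eqP <-; ring.
have: (g *m perp u) i 0 = (h *m perp u) i 0 by rewrite pe.
by rewrite !mulmx2E => /eqP; rewrite -subr_eq0 => /eqP <-; ring.
Qed.

(** Put w = y - x and u = y - (v - x).  The four norm conditions make v, w and u
    pairwise orthogonal, and a plane without isotropic vectors cannot hold
    three nonzero pairwise orthogonal vectors. *)
Lemma circle_sum_unique (t : F) v x y : v != 0 ->
    qnorm x = t -> qnorm (v - x) = t -> qnorm y = t -> qnorm (v - y) = t ->
  y = x \/ y = v - x.
Proof.
move=> nv nx nvx ny nvy.
have two0 := two_neq0 q3.
have vw: dot v (y - x) = 0.
  apply: (mulfI two0); rewrite mulr0.
  transitivity (qnorm y - qnorm x + (qnorm (v - x) - qnorm (v - y))).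
    by rewrite /dot /qnorm !mxE; ring.
  by rewrite nx nvx ny nvy; ring.
have [->|nyx] := eqVneq y x; [by left | right].
apply/eqP; rewrite -subr_eq0; apply/eqP; set u := _ - _.
have dwu : dot (y - x) u = 0.
  transitivity (qnorm y - qnorm x - dot v (y - x)).
    by rewrite /u /dot /qnorm !mxE; ring.
  by rewrite vw ny nx; ring.
have dvu : dot v u = 0.
  apply: (mulfI two0); rewrite mulr0.
  transitivity (qnorm x - qnorm (v - x) + (qnorm y - qnorm (v - y))).
    by rewrite /u /dot /qnorm !mxE; ring.
  by rewrite nx nvx ny nvy; ring.
have nyx' : y - x != 0 by rewrite subr_eq0.
apply: (dot_perp_eq0 nv dvu).
suff : dot (perp v) u * qnorm (y - x) = 0.
  by move/eqP; rewrite mulf_eq0 qnorm_eq0 (negPf nyx') orbF => /eqP.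
(* expand perp v and u in the orthogonal basis y - x, perp (y - x) *)
transitivity (dot (perp v) (y - x) * dot (y - x) u
              + dot v (y - x) * dot (perp (y - x)) u).
  by rewrite /dot /qnorm !(perp0, perp1) !mxE; ring.
by rewrite dwu vw; ring.
Qed.

End Plane.

(** * Two inequalities for finite sums *)

(** Expand the nonnegative double sum of the (u i - u j)^2. *)
Lemma sqr_sum_le (K : numDomainType) (I : finType) (P : {pred I}) (u : I -> K) :
    (forall i, i \in P -> u i \is Num.real) ->
  (\sum_(i in P) u i) ^+ 2 <= #|P|%:R * \sum_(i in P) u i ^+ 2.
Proof.
move=> ur; set S := \sum_(i in P) u i; set Q := \sum_(i in P) _.
have : 0 <= \sum_(i in P) \sum_(j in P) (u i - u j) ^+ 2.
  by do 2![apply: sumr_ge0 => ? ?]; rewrite real_exprn_even_ge0 ?rpredB ?ur.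
have -> : \sum_(i in P) \sum_(j in P) (u i - u j) ^+ 2
          = 2%:R * (#|P|%:R * Q - S ^+ 2).
  transitivity (\sum_(i in P) (u i ^+ 2 * #|P|%:R - 2%:R * u i * S + Q)).
    apply: eq_bigr => i _; rewrite mulr_natr -sumr_const mulr_sumr.
    by rewrite -sumrB -big_split /=; apply: eq_bigr => j _; ring.
  rewrite big_split sumrB /= -!mulr_suml -mulr_sumr sumr_const -/S -/Q.
  by rewrite -[Q *+ _]mulr_natr; ring.
by rewrite pmulr_rge0 ?ltr0n // subr_ge0.
Qed.

Lemma mulr_le_half_sqr (K : numFieldType) (x y : K) :
  x \is Num.real -> y \is Num.real -> x * y <= (x ^+ 2 + y ^+ 2) / 2%:R.
Proof.
move=> xr yr; rewrite ler_pdivlMr ?ltr0n // -subr_ge0.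
have -> : x ^+ 2 + y ^+ 2 - x * y * 2%:R = (x - y) ^+ 2 by ring.
by rewrite real_exprn_even_ge0 ?rpredB.
Qed.

(** * Fourier analysis on the plane *)

Definition additive_character (F : finFieldType) (psi : F -> algC) :=
  [/\ {morph psi : x y / x + y >-> x * y}, forall x, `|psi x| = 1
    & exists x, psi x != 1].

(** The irreducible characters of the additive group are linear and have
    trivial common kernel, so one of them takes a value other than 1 at the
    element 1 of the field. *)
Lemma additive_character_exists (F : finFieldType) :
  exists psi : F -> algC, additive_character psi.
Proof.
have abF : abelian [set: F]%G.
  by apply/centsP=> x _ y _; rewrite /commute !FinRing.Theory.zmodMgE addrC.
have /char_abelianP lin := abF.
have : (1 : F) \notin \bigcap_i cfker 'chi[[set: F]%G]_i.
  by rewrite TI_cfker_irr inE FinRing.Theory.zmod1gE oner_eq0.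
move=> /bigcapP nin.
have [i hi] : exists i, (1 : F) \notin cfker 'chi[[set: F]%G]_i.
  apply/existsP; rewrite -negb_forall; apply/negP => /forallP h.
  by apply: nin => i _; apply: h.
exists 'chi_i; split.
- by move=> x y; rewrite -FinRing.Theory.zmodMgE (lin_charM (lin i)) ?inE.
- by move=> x; rewrite (normC_lin_char (lin i)) ?inE.
exists 1; apply: contraNneq hi => e.
by rewrite cfkerEirr inE (lin_char1 (lin i)) e.
Qed.

(** The dot product identifies the plane with its dual group, so frequencies are
    vectors of the plane and O(2) acts on them in the same way. *)
Definition fourier (F : finFieldType) (psi : F -> algC) (k : 'cV[F]_2 -> algC)
    (x : 'cV[F]_2) : algC := \sum_v k v * psi (dot x v).

Definition convolution (F : finFieldType) (h k : 'cV[F]_2 -> algC)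
    (v : 'cV[F]_2) : algC := \sum_x h x * k (v - x).

Section Fourier.
Variables (F : finFieldType) (psi : F -> algC).
Hypothesis psi_char : additive_character psi.
Notation V := 'cV[F]_2.
Local Notation hat := (fourier psi).
Implicit Types (h k : V -> algC) (x v : V).

Lemma charD (x y : F) : psi (x + y) = psi x * psi y.
Proof. by case: psi_char. Qed.

Lemma norm_char (x : F) : `|psi x| = 1.
Proof. by case: psi_char. Qed.

Lemma char0 : psi 0 = 1.
Proof.
apply: (@mulfI _ (psi 0)); first by rewrite -normr_eq0 norm_char oner_eq0.
by rewrite -charD addr0 mulr1.
Qed.

Lemma charN (x : F) : psi (- x) = (psi x)^*.
Proof.
have n0: psi x != 0 by rewrite -normr_eq0 norm_char oner_eq0.
by apply: (mulfI n0); rewrite -charD subrr char0 -normCK norm_char expr1n.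
Qed.

(** For v <> 0 some translation of x multiplies the summand by a constant other
    than 1. *)
Lemma sum_char v :
  \sum_(x : V) psi (dot x v) = if v == 0 then (#|F| ^ 2)%:R else 0.
Proof.
case: ifP => [/eqP->|/negbT nv].
  rewrite (eq_bigr (fun=> 1)) => [|x _]; last by rewrite dot0r char0.
  by rewrite sumr_const card_mx.
have [_ _ [a na]] := psi_char.
have [i ni] : exists i, v i 0 != 0.
  apply/existsP; apply: contraNT nv; rewrite negb_exists => /forallP v0.
  by apply/eqP/colP=> i; rewrite mxE; apply/eqP; rewrite -[_ == _]negbK v0.
pose c : V := \col_j (if j == i then a / v i 0 else 0).
have dc : dot c v = a.
  rewrite /dot !mxE; move: ni; case/orP: (ord2P i) => /eqP -> ni /=.
    by rewrite mul0r addr0 divfK.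
  by rewrite mul0r add0r divfK.
have e : \sum_(x : V) psi (dot x v) = psi a * \sum_(x : V) psi (dot x v).
  rewrite [LHS](reindex_inj (addrI c)) mulr_sumr; apply: eq_bigr => x _.
  by rewrite dotDl dc charD.
apply/eqP; move/eqP: e; rewrite -subr_eq0 -{1}[\sum_x _]mul1r -mulrBl mulf_eq0.
by rewrite subr_eq0 eq_sym (negPf na).
Qed.

Lemma plancherel k :
  \sum_x `|hat k x| ^+ 2 = (#|F| ^ 2)%:R * \sum_v `|k v| ^+ 2.
Proof.
transitivity (\sum_v \sum_w k v * (k w)^* * \sum_x psi (dot x (v - w))).
  under [RHS]eq_bigr => v _ do under eq_bigr => w _ do rewrite mulr_sumr.
  under [RHS]eq_bigr => v _ do rewrite exchange_big.
  rewrite [RHS]exchange_big; apply: eq_bigr => x _.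
  rewrite normCK rmorph_sum mulr_suml; apply: eq_bigr => v _.
  rewrite mulr_sumr; apply: eq_bigr => w _.
  by rewrite dotDr dotNr charD charN rmorphM /=; ring.
rewrite mulr_sumr; apply: eq_bigr => v _.
under eq_bigr => w _ do rewrite sum_char subr_eq0.
rewrite (bigD1 v) //= big1 ?addr0 => [|w nwv].
  by rewrite eqxx normCK mulrC.
by rewrite eq_sym (negPf nwv) mulr0.
Qed.

Lemma fourier_convolution h k x :
  hat (convolution h k) x = hat h x * hat k x.
Proof.
rewrite /fourier mulr_suml.
under eq_bigr => v _ do rewrite mulr_suml.
rewrite exchange_big; apply: eq_bigr => u _.
rewrite (reindex_inj (addrI u)) mulr_sumr; apply: eq_bigr => v _.
by rewrite addrC addKr (addrC u v) dotDr charD; ring.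
Qed.

End Fourier.

(** * The restriction estimate for circles *)

Section Circles.
Variables (F : finFieldType) (psi : F -> algC).
Hypotheses (q3 : (#|F| %% 4 = 3)%N) (psi_char : additive_character psi).
Notation V := 'cV[F]_2.
Local Notation hat := (fourier psi).
Implicit Types (h k : V -> algC) (x v : V).

Lemma circle_representations_le2 (t : F) v : v != 0 ->
  (#|[pred x | (qnorm x == t) && (qnorm (v - x) == t)]| <= 2)%N.
Proof.
move=> nv; set T := [pred x | _].
have [x0 Tx0|T0] := pickP T; last by rewrite eq_card0.
apply: leq_trans (card_size [:: x0; v - x0]); apply/subset_leq_card/subsetP.
move: Tx0 => /andP[/eqP nx0 /eqP nvx0] x /andP[/eqP nx /eqP nvx].
by rewrite !inE; case: (circle_sum_unique q3 nv nx0 nvx0 nx nvx) => ->;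
  rewrite eqxx ?orbT.
Qed.

(** For v <> 0 at most two terms contribute to the convolution at v, so its
    squared modulus is at most twice the sum of theirs, and the sum over v of
    these bounds is at most 2 s^2, with s the squared L^2 norm of h.  For v = 0
    the whole circle may contribute, but the convolution is at most s there. *)
Lemma circle_energy (t : F) h : (forall x, qnorm x != t -> h x = 0) ->
  \sum_v `|convolution h h v| ^+ 2 <= 3%:R * (\sum_x `|h x| ^+ 2) ^+ 2.
Proof.
move=> supp; set s := (X in 3%:R * X ^+ 2).
have zero_frequency : `|convolution h h 0| ^+ 2 <= s ^+ 2.
  rewrite lerXn2r ?nnegrE ?sumr_ge0 // => [x _|]; first by rewrite exprn_ge0.
  apply: (le_trans (ler_norm_sum _ _ _)).
  apply: (@le_trans _ _ (\sum_x (`|h x| ^+ 2 + `|h (- x)| ^+ 2) / 2%:R)).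
    by apply: ler_sum => x _; rewrite normrM sub0r mulr_le_half_sqr ?normr_real.
  have sN : \sum_(x : V) `|h (- x)| ^+ 2 = s.
    by rewrite /s [RHS](reindex_inj oppr_inj).
  rewrite -mulr_suml big_split /= sN.
  by rewrite -/s -mulr2n -[s *+ 2]mulr_natr mulfK // pnatr_eq0.
have other_frequency v : v != 0 ->
    `|convolution h h v| ^+ 2 <= 2%:R * \sum_x `|h x| ^+ 2 * `|h (v - x)| ^+ 2.
  move=> nv; pose T := [pred x | (qnorm x == t) && (qnorm (v - x) == t)].
  have -> : convolution h h v = \sum_(x in T) h x * h (v - x).
    rewrite [LHS](bigID T) /= [X in _ + X]big1 ?addr0 // => x.
    by rewrite negb_and => /orP[] /supp ->; rewrite ?mul0r ?mulr0.
  apply: (@le_trans _ _ ((\sum_(x in T) `|h x * h (v - x)|) ^+ 2)).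
    by rewrite lerXn2r ?nnegrE ?sumr_ge0 // ler_norm_sum.
  apply: le_trans (sqr_sum_le _) _ => [x _|]; first exact: normr_real.
  apply: ler_pM; first exact: ler0n.
  - by apply: sumr_ge0 => x _; rewrite exprn_ge0.
  - by rewrite ler_nat circle_representations_le2.
  rewrite [X in _ <= X](bigID T) /= -[X in X <= _]addr0 lerD //.
    by apply: ler_sum => x _; rewrite normrM exprMn.
  by apply: sumr_ge0 => x _; rewrite mulr_ge0 ?exprn_ge0.
rewrite (bigD1 0) //= (_ : 3%:R * s ^+ 2 = s ^+ 2 + 2%:R * (s * s));
  last by ring.
apply: lerD => //.
apply: (@le_trans _ _ (\sum_v 2%:R * \sum_x `|h x| ^+ 2 * `|h (v - x)| ^+ 2)).
  rewrite [X in _ <= X](bigD1 0) //= -[X in X <= _]add0r lerD ?ler_sum //.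
  by rewrite mulr_ge0 ?ler0n ?sumr_ge0 // => x _; rewrite mulr_ge0 ?exprn_ge0.
rewrite -mulr_sumr exchange_big /= {1}/s mulr_suml ler_pM2l ?ltr0n //.
apply: ler_sum => x _; rewrite -mulr_sumr ler_wpM2l ?exprn_ge0 //.
by rewrite /s [X in _ <= X](reindex_inj (addIr (- x))).
Qed.

(** The square of the transform of h is the transform of h * h, so Plancherel
    turns the fourth moment into the energy. *)
Lemma circle_extension (t : F) h : (forall x, qnorm x != t -> h x = 0) ->
  \sum_x `|hat h x| ^+ 4 <= 3%:R * (#|F| ^ 2)%:R * (\sum_x `|h x| ^+ 2) ^+ 2.
Proof.
move=> supp.
have -> : \sum_x `|hat h x| ^+ 4 = \sum_x `|hat (convolution h h) x| ^+ 2.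
  apply: eq_bigr => x _.
  by rewrite (fourier_convolution psi_char) normrM; ring.
rewrite (plancherel psi_char) mulrAC [X in _ <= X]mulrC.
by rewrite ler_wpM2l ?ler0n // (circle_energy supp).
Qed.

Definition indicator (A : {set V}) x : algC := (x \in A)%:R.

Lemma sum_indicator_sqr (A : {set V}) :
  \sum_x `|indicator A x| ^+ 2 = #|A|%:R.
Proof.
rewrite -sum1_card natr_sum [RHS]big_mkcond /=; apply: eq_bigr => x _.
by rewrite /indicator; case: (x \in A); rewrite ?normr1 ?expr1n ?normr0 ?expr0n.
Qed.

Lemma fourier_indicator (A : {set V}) x :
  hat (indicator A) x = \sum_(a in A) psi (dot x a).
Proof.
rewrite [RHS]big_mkcond; apply: eq_bigr => v _.
by rewrite /indicator; case: (v \in A); rewrite ?mul1r ?mul0r.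
Qed.

(** With h the transform of the indicator of A cut off to the circle, the mass s
    is the sum of the transform of h over -A.  Two applications of
    Cauchy-Schwarz bound s^4 by |A|^3 times the fourth moment of that
    transform, which is at most 3 q^2 s^2. *)
Lemma circle_restriction (A : {set V}) (t : F) :
  (\sum_(x | qnorm x == t) `|hat (indicator A) x| ^+ 2) ^+ 2
    <= 3%:R * (#|F| ^ 2)%:R * #|A|%:R ^+ 3.
Proof.
set s := \sum_(x | _) _.
have s_ge0 : 0 <= s by apply: sumr_ge0 => x _; rewrite exprn_ge0.
pose h x := if qnorm x == t then hat (indicator A) x else 0.
have supp x : qnorm x != t -> h x = 0 by rewrite /h => /negPf->.
have sE : \sum_x `|h x| ^+ 2 = s.
  rewrite /s [RHS]big_mkcond; apply: eq_bigr => x _ /=.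
  by rewrite /h; case: ifP; rewrite ?normr0 ?expr0n.
have s_dual : s = \sum_(a in A) hat h (- a).
  rewrite /s big_mkcond [RHS]exchange_big; apply: eq_bigr => x _ /=.
  rewrite -mulr_sumr /h; case: ifP => _; last by rewrite mul0r.
  rewrite normCK {2}fourier_indicator rmorph_sum; congr (_ * _).
  by apply: eq_bigr => a _; rewrite [dot (- a) x]dotC dotNr (charN psi_char).
have s4 : s ^+ 4 <= 3%:R * (#|F| ^ 2)%:R * #|A|%:R ^+ 3 * s ^+ 2.
  have s1 : s <= \sum_(a in A) `|hat h (- a)|.
    by rewrite -[s]ger0_norm // s_dual ler_norm_sum.
  have s2 : s ^+ 2 <= #|A|%:R * \sum_(a in A) `|hat h (- a)| ^+ 2.
    apply: le_trans (sqr_sum_le _); last by move=> a _; apply: normr_real.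
    by rewrite lerXn2r ?nnegrE // (le_trans s_ge0).
  rewrite -[4%N]/(2 * 2)%N exprM.
  apply: (@le_trans _ _ ((#|A|%:R * \sum_(a in A) `|hat h (- a)| ^+ 2) ^+ 2)).
    rewrite lerXn2r ?nnegrE ?exprn_ge0 // mulr_ge0 ?ler0n ?sumr_ge0 // => a _.
    by rewrite exprn_ge0.
  have sum4 : \sum_(a in A) (`|hat h (- a)| ^+ 2) ^+ 2
      <= 3%:R * (#|F| ^ 2)%:R * s ^+ 2.
    rewrite -sE; apply: le_trans (circle_extension supp).
    rewrite [X in _ <= X](reindex_inj oppr_inj) /=.
    rewrite [X in _ <= X](bigID (mem A)) /= -[X in X <= _]addr0.
    rewrite lerD ?sumr_ge0 // => [|a _]; last exact: exprn_ge0.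
    by apply: ler_sum => a _; rewrite -exprM.
  rewrite exprMn -mulrA -/s.
  apply: (@le_trans _ _
    (#|A|%:R ^+ 2 * (#|A|%:R * (3%:R * (#|F| ^ 2)%:R * s ^+ 2)))).
    rewrite ler_wpM2l ?exprn_ge0 ?ler0n //.
    apply: le_trans (sqr_sum_le _) _ => [a _|].
      by rewrite rpredX ?normr_real.
    by rewrite ler_wpM2l ?ler0n.
  by rewrite le_eqVlt; apply/orP; left; apply/eqP; ring.
have [->|ns] := eqVneq s 0.
  by rewrite expr0n !mulr_ge0 ?ler0n ?exprn_ge0 ?ler0n.
have s_gt0 : 0 < s ^+ 2 by rewrite exprn_gt0 // lt_def ns.
by rewrite -(ler_pM2r s_gt0) -exprD.
Qed.

End Circles.

(** * The second moment of the overlap *)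

Definition overlap (F : finFieldType) (A B : {set 'cV[F]_2})
    (m : 'M[F]_2 * 'cV[F]_2) : nat :=
  #|[set b in B | m.1 *m b + m.2 \in A]|.

Lemma incidences_overlap (F : finFieldType) (A B : {set 'cV[F]_2})
    (M : {set 'M[F]_2 * 'cV[F]_2}) :
  incidences (setX A B) M = (\sum_(m in M) overlap A B m)%N.
Proof.
rewrite /incidences -sum1_card (partition_big (fun t => t.2) (mem M)) /=;
  last by move=> t; rewrite inE => /and3P[].
apply: eq_bigr => m Mm; rewrite sum1_card /overlap.
pose f b := ((m.1 *m b + m.2, b), m).
rewrite -(card_imset _ (f := f)) => [|b c []//].
apply: eq_card => -[[a b] n]; apply/idP/imsetP.
  rewrite unfold_in /= !inE /= => /andP[/and3P[/andP[Aa Bb] _ /eqP e] /eqP nm].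
  by rewrite nm in e *; exists b; rewrite ?inE ?Bb -?e //= /f -e.
case=> c; rewrite inE => /andP[Bc Ac] [-> -> ->].
by rewrite unfold_in /= !inE /= Ac Bc Mm !eqxx.
Qed.

Section Second_moment.
Variables (F : finFieldType) (psi : F -> algC).
Hypotheses (q3 : (#|F| %% 4 = 3)%N) (psi_char : additive_character psi).
Notation V := 'cV[F]_2.
Local Notation hat := (fourier psi).
Local Notation q := (#|F|).
Implicit Types (A B : {set V}).

(** Grouping the g in O(2) by x = g y, every pair (x, y) with y <> 0 and x of
    the same norm as y occurs at most twice. *)
Lemma sum_O2_le (U W : V -> algC) :
    (forall x, 0 <= U x) -> (forall x, 0 <= W x) ->
  \sum_(g in O2 F) \sum_(y | y != 0) U (g *m y) * W y
    <= 2%:R * \sum_y \sum_(x | qnorm x == qnorm y) U x * W y.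
Proof.
move=> U0 W0; rewrite exchange_big /= mulr_sumr big_mkcond /=.
apply: ler_sum => y _; case: ifP => [ny|_]; last first.
  by rewrite mulr_ge0 ?ler0n ?sumr_ge0 // => x _; rewrite mulr_ge0.
rewrite (partition_big (fun g => g *m y) (fun x => qnorm x == qnorm y)) /=;
  last by move=> g Og; rewrite O2_qnorm.
rewrite mulr_sumr; apply: ler_sum => x _.
under eq_bigr => g /andP[_ /eqP ->] do over.
rewrite sumr_const -[X in X <= _]mulr_natl ler_wpM2r ?mulr_ge0 // ler_nat.
apply: leq_trans (O2_fiber_le2 q3 x ny).
by apply/eq_leq/eq_card => g; rewrite [RHS]inE.
Qed.

Lemma overlapE A B m :
  (overlap A B m)%:R = \sum_(b in B) indicator A (m.1 *m b + m.2).
Proof.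
rewrite /overlap -sum1_card natr_sum [LHS]big_mkcond [RHS]big_mkcond /=.
by apply: eq_bigr => b _; rewrite inE /indicator; do 2!case: (_ \in _).
Qed.

(** The overlap is a correlation of A with the image of B.  Its transform is
    taken at g y rather than y because psi (g y . g b) = psi (y . b) then leaves
    B^ free of g. *)
Lemma fourier_overlap A B g y : g \in O2 F ->
  hat (fun z => (overlap A B (g, z))%:R) (g *m y)
    = hat (indicator A) (g *m y) * (hat (indicator B) y)^*.
Proof.
move=> Og; rewrite /fourier.
transitivity (\sum_z \sum_(b in B)
                 indicator A (g *m b + z) * psi (dot (g *m y) z)).
  apply: eq_bigr => z _; rewrite -mulr_suml; congr (_ * _).
  exact: overlapE.
rewrite exchange_big -/(hat (indicator B) y) fourier_indicator rmorph_sum.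
rewrite mulr_sumr.
apply: eq_bigr => b _ /=; rewrite (reindex_inj (addrI (- (g *m b)))) mulr_suml.
apply: eq_bigr => a _; rewrite addrA subrr add0r dotDr dotNr O2_dot //.
by rewrite (charD psi_char) (charN psi_char); ring.
Qed.

Lemma sum_overlap A B g :
  \sum_z (overlap A B (g, z))%:R = #|A|%:R * #|B|%:R :> algC.
Proof.
under eq_bigr => z _ do rewrite overlapE.
rewrite exchange_big /= (eq_bigr (fun=> #|A|%:R)) => [|b _].
  by rewrite sumr_const -[LHS]mulr_natr.
rewrite (reindex_inj (addrI (- (g *m b)))) -sum1_card natr_sum.
rewrite [RHS]big_mkcond /=.
by apply: eq_bigr => a _; rewrite addrA subrr add0r /indicator; case: (a \in A).
Qed.

Definition mean_overlap A B : algC := #|A|%:R * #|B|%:R / (q ^ 2)%:R.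

Lemma card_field_neq0 : (q ^ 2)%:R != 0 :> algC.
Proof.
by rewrite pnatr_eq0 expn_eq0 andbT -lt0n (leq_trans _ (finNzRing_gt1 F)).
Qed.

(** Plancherel in z; subtracting the mean removes exactly the zero frequency. *)
Lemma variance_overlap A B g : g \in O2 F ->
  (q ^ 2)%:R * \sum_z `|(overlap A B (g, z))%:R - mean_overlap A B| ^+ 2
    = \sum_(y | y != 0)
        `|hat (indicator A) (g *m y)| ^+ 2 * `|hat (indicator B) y| ^+ 2.
Proof.
move=> Og; pose f z : algC := (overlap A B (g, z))%:R - mean_overlap A B.
have fE y : hat f y = hat (fun z => (overlap A B (g, z))%:R) y
     - mean_overlap A B * (if y == 0 then (q ^ 2)%:R else 0).
  rewrite -(sum_char psi_char) /fourier mulr_sumr -sumrB; apply: eq_bigr => z _.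
  by rewrite mulrBl [dot z y]dotC.
rewrite -(plancherel psi_char f) (bigD1 0) //=.
have -> : hat f 0 = 0.
  rewrite fE eqxx /mean_overlap divfK ?card_field_neq0 // -(sum_overlap A B g).
  apply/eqP; rewrite subr_eq0; apply/eqP/eq_bigr => z _.
  by rewrite dotC dot0r (char0 psi_char) mulr1.
rewrite normr0 expr0n add0r (reindex_inj (O2_inj q3 Og)) /=.
have g0 (y : V) : (g *m y != 0) = (y != 0) by rewrite -!(qnorm_eq0 q3) O2_qnorm.
apply: eq_big => [y|y]; rewrite g0 // => ny.
have gy0 : (g *m y == 0) = false by apply/negbTE; rewrite g0.
by rewrite fE gy0 mulr0 subr0 fourier_overlap // normrM norm_conjC exprMn.
Qed.

(** The restriction estimate bounds the inner sum over each circle, and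
    Plancherel evaluates the remaining sum over y. *)
Lemma sum_circles_le A B :
  (\sum_y \sum_(x | qnorm x == qnorm y)
     `|hat (indicator A) x| ^+ 2 * `|hat (indicator B) y| ^+ 2) ^+ 2
    <= 3%:R * (q ^ 2)%:R ^+ 3 * #|A|%:R ^+ 3 * #|B|%:R ^+ 2.
Proof.
pose c : algC := 3%:R * (q ^ 2)%:R * #|A|%:R ^+ 3.
have c0 : 0 <= c by rewrite !mulr_ge0 ?exprn_ge0 ?ler0n.
have circle_le t :
    \sum_(x | qnorm x == t) `|hat (indicator A) x| ^+ 2 <= sqrtC c.
  have s0 : 0 <= \sum_(x | qnorm x == t) `|hat (indicator A) x| ^+ 2.
    by apply: sumr_ge0 => x _; rewrite exprn_ge0.
  rewrite -[X in X <= _]sqrCK // ler_sqrtC ?nnegrE ?exprn_ge0 //.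
  exact: circle_restriction.
apply: (@le_trans _ _ ((sqrtC c * ((q ^ 2)%:R * #|B|%:R)) ^+ 2)); last first.
  rewrite exprMn sqrtCK /c le_eqVlt.
  by apply/orP; left; apply/eqP; ring.
rewrite lerXn2r ?nnegrE.
- by [].
- by do 2![apply: sumr_ge0 => ? _]; rewrite mulr_ge0 ?exprn_ge0.
- by rewrite !mulr_ge0 ?sqrtC_ge0 ?ler0n.
rewrite -sum_indicator_sqr -(plancherel psi_char) mulr_sumr.
apply: ler_sum => y _; rewrite -mulr_suml ler_wpM2r ?exprn_ge0 //.
Qed.

Lemma sum_circles_sym (U W : V -> algC) :
  \sum_y \sum_(x | qnorm x == qnorm y) U x * W y
    = \sum_y \sum_(x | qnorm x == qnorm y) W x * U y.
Proof.
rewrite (exchange_big_dep predT) //=; apply: eq_bigr => x _.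
by apply: eq_big => [y|y _]; [rewrite eq_sym | rewrite mulrC].
Qed.

Definition second_moment A B : algC :=
  \sum_(g in O2 F) \sum_z `|(overlap A B (g, z))%:R - mean_overlap A B| ^+ 2.

Lemma second_moment_ge0 A B : 0 <= second_moment A B.
Proof. by do 2![apply: sumr_ge0 => ? _]; rewrite exprn_ge0. Qed.

(** The sum over pairs on a common circle is symmetric in the two transforms, so
    the restriction estimate may be applied to the smaller of A and B. *)
Lemma second_moment_le A B :
  second_moment A B ^+ 2
    <= 12%:R * q%:R ^+ 2 * #|A|%:R ^+ 2 * #|B|%:R ^+ 2 * (minn #|A| #|B|)%:R.
Proof.
pose U x := `|hat (indicator A) x| ^+ 2.
pose W x := `|hat (indicator B) x| ^+ 2.
pose T := \sum_y \sum_(x | qnorm x == qnorm y) U x * W y.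
have E_le_T : (q ^ 2)%:R * second_moment A B <= 2%:R * T.
  rewrite /second_moment mulr_sumr.
  rewrite (eq_bigr _ (fun g Og => variance_overlap A B Og)).
  by apply: sum_O2_le => x; rewrite exprn_ge0.
have T_le : T ^+ 2 <= 3%:R * (q ^ 2)%:R ^+ 3 * (#|A|%:R ^+ 2 * #|B|%:R ^+ 2)
                      * (minn #|A| #|B|)%:R.
  rewrite /minn; case: ifP => _.
    apply: le_trans (sum_circles_le A B) _.
    by rewrite le_eqVlt; apply/orP; left; apply/eqP; ring.
  rewrite /T sum_circles_sym; apply: le_trans (sum_circles_le B A) _.
  by rewrite le_eqVlt; apply/orP; left; apply/eqP; ring.
have q4_gt0 : 0 < (q ^ 2)%:R ^+ 2 :> algC.
  by rewrite exprn_gt0 // lt_def card_field_neq0 ler0n.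
rewrite -(ler_pM2l q4_gt0) -exprMn.
apply: (@le_trans _ _ ((2%:R * T) ^+ 2)).
  rewrite lerXn2r ?nnegrE //.
  - by rewrite mulr_ge0 ?ler0n ?second_moment_ge0.
  by apply: le_trans E_le_T; rewrite mulr_ge0 ?ler0n ?second_moment_ge0.
rewrite exprMn; apply: le_trans (ler_wpM2l _ T_le) _.
  by rewrite exprn_ge0.
by rewrite le_eqVlt; apply/orP; left; apply/eqP; rewrite natrX; ring.
Qed.

Lemma incidences_deviation_algC A B (M : {set 'M[F]_2 * V}) :
    M \subset rigid_motions F ->
  `|(incidences (setX A B) M)%:R - #|M|%:R * mean_overlap A B| ^+ 4
    <= 12%:R * q%:R ^+ 2 * #|M|%:R ^+ 2 * #|A|%:R ^+ 2 * #|B|%:R ^+ 2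
       * (minn #|A| #|B|)%:R.
Proof.
move=> Msub; pose d m : algC := `|(overlap A B m)%:R - mean_overlap A B|.
have d_sum : \sum_(m in M) d m ^+ 2 <= second_moment A B.
  rewrite /second_moment pair_big_dep /= [X in _ <= X](bigID (mem M)) /=.
  rewrite -[X in X <= _]addr0 lerD //; last first.
    by apply: sumr_ge0 => m _; rewrite exprn_ge0.
  rewrite le_eqVlt; apply/orP; left; apply/eqP.
  apply: eq_big => [[g z]|[g z] _ //] /=.
  case Mm: (_ \in M); rewrite ?andbF // andbT; move/subsetP: Msub => /(_ _ Mm).
  by rewrite in_setX => /andP[-> _].
rewrite incidences_overlap.
have dev1 : `|(\sum_(m in M) overlap A B m)%:R - #|M|%:R * mean_overlap A B|
    <= \sum_(m in M) d m.
  rewrite natr_sum mulr_natl -sumr_const -sumrB; exact: ler_norm_sum.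
have dev2 :
  `|(\sum_(m in M) overlap A B m)%:R - #|M|%:R * mean_overlap A B| ^+ 2
    <= #|M|%:R * second_moment A B.
  apply: (@le_trans _ _ ((\sum_(m in M) d m) ^+ 2)).
    by rewrite lerXn2r ?nnegrE // (le_trans _ dev1).
  apply: le_trans (sqr_sum_le _) _ => [m _|]; first exact: normr_real.
  by rewrite ler_wpM2l ?ler0n.
rewrite -[4%N]/(2 * 2)%N exprM.
apply: (@le_trans _ _ ((#|M|%:R * second_moment A B) ^+ 2)).
  by rewrite lerXn2r ?nnegrE ?exprn_ge0 // (le_trans _ dev2) ?exprn_ge0.
rewrite exprMn; apply: le_trans (ler_wpM2l _ (second_moment_le A B)) _.
  by rewrite exprn_ge0.
by rewrite le_eqVlt; apply/orP; left; apply/eqP; ring.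
Qed.

End Second_moment.

(** Multiplied by q^8, both sides are integers, so the inequality does not
    depend on the ordered field in which it is read. *)
Lemma incidences_deviation (R : realFieldType) (F : finFieldType)
    (A B : {set 'cV[F]_2}) (M : {set 'M[F]_2 * 'cV[F]_2}) :
    (#|F| %% 4 = 3)%N -> M \subset rigid_motions F ->
  `|(incidences (setX A B) M)%:R
     - #|A|%:R * #|B|%:R * #|M|%:R / #|F|%:R ^+ 2| ^+ 4
    <= 12%:R * #|F|%:R ^+ 2 * #|M|%:R ^+ 2 * #|A|%:R ^+ 2 * #|B|%:R ^+ 2
       * (minn #|A| #|B|)%:R :> R.
Proof.
move=> q3 Msub; have [psi psi_char] := additive_character_exists F.
set I := incidences _ _; set q := #|F|.
have q_gt0 : (0 < q)%N := ltnW (finNzRing_gt1 F).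
pose D : int := I%:Z * q%:Z ^+ 2 - #|A|%:Z * #|B|%:Z * #|M|%:Z.
pose E : int := 12%N%:Z * q%:Z ^+ 2 * #|M|%:Z ^+ 2 * #|A|%:Z ^+ 2 * #|B|%:Z ^+ 2
       * (minn #|A| #|B|)%:Z.
have transfer (K : numFieldType) :
  (`|I%:R - #|A|%:R * #|B|%:R * #|M|%:R / q%:R ^+ 2| ^+ 4
    <= 12%:R * q%:R ^+ 2 * #|M|%:R ^+ 2 * #|A|%:R ^+ 2 * #|B|%:R ^+ 2
       * (minn #|A| #|B|)%:R :> K) = (`|D| ^+ 4 <= E * q%:Z ^+ 8).
  have qK : 0 < q%:R ^+ 2 :> K by rewrite exprn_gt0 ?ltr0n.
  have normD : `|D|%:~R
      = `|I%:R - #|A|%:R * #|B|%:R * #|M|%:R / q%:R ^+ 2| * q%:R ^+ 2 :> K.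
    rewrite -[X in _ = _ * X](gtr0_norm qK) -normrM mulrBl divfK ?gt_eqF //.
    by rewrite intr_norm /D !(rmorphM, rmorphB, rmorphXn) /= -!pmulrn.
  rewrite -[LHS](ler_pM2r (exprn_gt0 4 qK)) -exprMn -normD -exprM.
  by rewrite -(ler_int K) /E !(rmorphM, rmorphXn) /= -!pmulrn.
rewrite transfer -(transfer algC).
have := incidences_deviation_algC q3 psi_char A B Msub.
rewrite /mean_overlap natrX; congr (`|_ - _| ^+ 4 <= _); ring.
Qed.

Theorem theorem3p3 (R : realType) :
  exists C : R, 0 < C /\
    forall (q : nat) (F : finFieldType) (A B : {set 'cV[F]_2})
           (P : {set 'cV[F]_2 * 'cV[F]_2}) (M : {set 'M[F]_2 * 'cV[F]_2}),
      #|F| = q -> (q %% 4 = 3)%N ->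
      P = setX A B -> M \subset rigid_motions F ->
      `| (incidences P M)%:R - #|P|%:R * #|M|%:R / q%:R ^+ 2 | <=
        C * (q%:R `^ (1 / 2) * #|P|%:R `^ (1 / 2) * #|M|%:R `^ (1 / 2) *
             Num.min (#|A|%:R `^ (1 / 4)) (#|B|%:R `^ (1 / 4))).
Proof.
(* any constant whose fourth power is at least 12 works *)
exists 2%:R; split=> [|q F A B P M <- q3 -> Msub]; first by rewrite ltr0n.
have half (x : nat) : (x%:R `^ (1 / 2)) ^+ 4 = x%:R ^+ 2 :> R.
  rewrite -powR_mulrn ?powR_ge0 // -powRrM -powR_mulrn ?ler0n //.
  by congr (_ `^ _); lra.
have quarter (x : nat) : (x%:R `^ (1 / 4)) ^+ 4 = x%:R :> R.
  rewrite -powR_mulrn ?powR_ge0 // -powRrM.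
  by rewrite (_ : 1 / 4 * 4%:R = 1) ?powRr1 ?ler0n //; lra.
have minE : Num.min (#|A|%:R `^ (1 / 4)) (#|B|%:R `^ (1 / 4)) ^+ 4
    = (minn #|A| #|B|)%:R :> R.
  have mono (x y : nat) : (x <= y)%N -> x%:R `^ (1 / 4) <= y%:R `^ (1 / 4) :> R.
    by move=> xy; rewrite ge0_ler_powR ?nnegrE ?ler0n ?ler_nat //; lra.
  case: (leqP #|A| #|B|) => [AB|/ltnW BA].
    by rewrite (min_idPl (mono _ _ AB)) quarter.
  by rewrite (min_idPr (mono _ _ BA)) quarter.
rewrite -(@ler_pXn2r _ 4) ?nnegrE //; last first.
  by rewrite !mulr_ge0 ?ler0n ?powR_ge0 // le_min !powR_ge0.
rewrite cardsX {1}natrM; apply: le_trans (incidences_deviation _ _ _ q3 Msub) _.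
rewrite !exprMn !half minE natrM exprMn.
set Y := (X in _ <= 2%:R ^+ 4 * X).
rewrite [X in X <= _](_ : _ = 12%:R * Y); last by rewrite /Y; ring.
by rewrite ler_wpM2r -?natrX ?ler_nat // /Y !mulr_ge0 ?exprn_ge0 ?ler0n.
Qed.
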